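(* Let $G$ be a finite group and $F$ a field whose characteristic does not divide the group order $|G|$. Then for any $G$-module $V$ over $F$ we have \[ \beta(F[V]^{G})\le \operatorname{topdeg} F[V]_{G}+1\le \beta(G)\le|G|. \] In particular, \[ \operatorname{topdeg}(G)+1:=\sup_V \operatorname{topdeg} F[V]_{G} +1=\beta(G), \] where the supremum is over all $G$-modules $V$ over $F$.
   Context: $G$ is a finite group and $F$ a field. A $G$-module is a finite-dimensional representation $V$ of $G$ over $F$. $F[V]=S(V^* )$ is the symmetric algebra on the dual space (a polynomial ring in $\dim_F V$ variables, graded by degree), on which $G$ acts by $\sigma(f)=f\circ\sigma^{-1}$. $F[V]^G$ is the ring of invariants; $F[V]^G_+$ is the set of invariants with zero constant term, i.e. the ideal of $F[V]^G$ spanned by homogeneous invariants of positive degree. The Noether number $\beta(F[V]^G)$ is the smallest number $b$ such that the invariants of degree $\le b$ generate $F[V]^G$ as an $F$-algebra, and $\beta(G)=\sup_V\beta(F[V]^G)$, the supremum over all $G$-modules $V$ over $F$. The Hilbert ideal is the ideal $I=F[V]^G_+F[V]$ of $F[V]$, and the algebra of coinvariants is the finite-dimensional graded algebra $F[V]_G=F[V]/I$. Its top degree $\operatorname{topdeg}F[V]_G$ is the largest degree in which $F[V]_G$ is non-zero. *)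

(* Defs.v *)
From HB Require Import structures.
From mathcomp Require Import all_boot all_order all_algebra all_fingroup.
From mathcomp Require Import all_solvable mxrepresentation.
From mathcomp Require Import generic_quotient ring_quotient.
(* mpoly must be loaded before constructive_ereal: the levels of their
   notations clash in the other order. *)
From mathcomp Require Import mpoly.
From mathcomp Require Import boolp classical_sets constructive_ereal.

Set Implicit Arguments.
Unset Strict Implicit.
Unset Printing Implicit Defensive.

Import Order.TTheory GRing.Theory Num.Theory.

Local Open Scope quotient_scope.
Local Open Scope classical_set_scope.
Local Open Scope ring_scope.

(* A G-module of dimension n is given by a matrix representation rG of G of
   degree n, where g acts on V = F^n by the left action v |-> rG g *m v on
   column vectors, and F[V] = S(V^* ) is {mpoly F[n]}, 'X_i being the i-th
   coordinate function on V. *)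

Section Invariants.

Variables (F : fieldType) (gT : finGroupType) (G : {group gT}).
Variables (n : nat) (rG : mx_representation F G n).

(* f o g^-1: the i-th coordinate of g^-1 v = rG g^-1 *m v is substituted for
   'X_i. *)
Definition poly_act (g : gT) (f : {mpoly F[n]}) : {mpoly F[n]} :=
  f \mPo [tuple \sum_(j < n) (rG g^-1%g i j *: 'X_j) | i < n].

Definition invariants : set {mpoly F[n]} :=
  [set f | forall g, g \in G -> poly_act g f = f].

Definition invariants_pos : set {mpoly F[n]} :=
  [set f | invariants f /\ f@_0%MM = 0].

Definition subalg_gen (S : set {mpoly F[n]}) : set {mpoly F[n]} :=
  smallest (fun A : set {mpoly F[n]} => GRing.subalg_closed (mem A)) S.

(* msize f is the degree of f plus one. *)
Definition generated_in_degree (b : nat) : Prop :=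
  subalg_gen [set f | invariants f /\ (msize f <= b.+1)%N] = invariants.

(* Degrees and degree bounds take values in N u {+oo}, embedded in \bar int,
   where every nonempty subset has an infimum and a supremum in \bar int; the
   infimum below is attained if the set is nonempty and is +oo otherwise. *)
Definition noether_number : \bar int :=
  infimum +oo%E [set b%:Z%:E | b in generated_in_degree].

Definition hilbert_ideal : {pred {mpoly F[n]}} :=
  fun f => `[< exists s : seq ({mpoly F[n]} * {mpoly F[n]}),
      (forall p, p \in s -> invariants_pos p.1)
      /\ f = \sum_(p <- s) p.1 * p.2 >].

Fact hilbert_ideal_closed : idealr_closed hilbert_ideal.
Proof.
split.
- by apply/asboolP; exists [::]; split=> //; rewrite big_nil.
- apply/negP => /asboolP[s [s_inv /(congr1 (mcoeff 0%MM))]].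
  rewrite mcoeff1 eqxx raddf_sum big1_seq => [/eqP|p /andP[_ /s_inv[_ p0]]].
    by rewrite oner_eq0.
  by rewrite /= rmorphM /= p0 mul0r.
- move=> a u v /asboolP[s [s_inv ->]] /asboolP[t [t_inv ->]]; apply/asboolP.
  exists ([seq (p.1, a * p.2) | p <- s] ++ t); split=> [p|].
    rewrite mem_cat => /orP[/mapP[q /s_inv q_inv ->]|/t_inv] //.
  rewrite big_cat big_map mulr_sumr; congr (_ + _).
  by apply: eq_bigr => p _; rewrite mulrCA.
Qed.

HB.instance Definition _ :=
  isIdealr.Build {mpoly F[n]} hilbert_ideal hilbert_ideal_closed.

Definition coinvariants := {ideal_quot hilbert_ideal}.

Definition coinvariants_homog (d : nat) : set coinvariants :=
  [set \pi_coinvariants f | f in [set f : {mpoly F[n]} | f \is d.-homog]].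

Definition topdeg : \bar int :=
  supremum -oo%E [set d%:Z%:E | d in
    [set d : nat | exists2 x, coinvariants_homog d x & x != 0]].

End Invariants.

Definition group_noether_number (F : fieldType) (gT : finGroupType)
    (G : {group gT}) : \bar int :=
  supremum -oo%E [set x | exists n (rG : mx_representation F G n),
    x = noether_number rG].

Definition group_topdeg (F : fieldType) (gT : finGroupType)
    (G : {group gT}) : \bar int :=
  supremum -oo%E [set x | exists n (rG : mx_representation F G n), x = topdeg rG].

(* Main.v *)
From HB Require Import structures.
Require Import Defs.
From mathcomp Require Import all_boot all_order all_algebra all_fingroup.
From mathcomp Require Import all_solvable mxrepresentation.
From mathcomp Require Import generic_quotient ring_quotient.
From mathcomp Require Import mpoly.
From mathcomp Require Import boolp classical_sets constructive_ereal.

(** Write I for the Hilbert ideal and d for the top degree of the coinvariants,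
    so that d is the largest degree of a homogeneous polynomial outside I. Three
    estimates give the theorem; the first two together bound Noether numbers by
    |G|.

    Upper bound for the top degree, d < |G| ([hilbert_ideal_Noether]): this is
    Benson's form of the Noether bound. Given one polynomial f_s without
    constant term for each s in G, every term of the sum over t in G of
    prod_s (f_s - t s f_s) vanishes, because of the factor s = t^-1. Expanding
    the products, every term other than |G| prod_s f_s is a multiple of an orbit
    sum without constant term, hence in I. As |G| is invertible, the product of
    the f_s lies in I, and so does every monomial of degree at least |G|.

    The Noether number is at most d + 1 ([generated_in_degree_hilbert]): all
    polynomials of degree d + 1 are in I, so a homogeneous invariant f of larger
    degree is a combination of homogeneous invariants of positive degree at most
    d + 1. The Reynolds operator makes the coefficients invariant; they have
    smaller degree than f, and induction on the degree applies.

    The group Noether number is at least d + 1 ([generated_in_degree_ext]):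
    choose u homogeneous of degree d outside I, and add to V a copy of the
    regular representation, with coordinates y_h for h in G. Then
    sum_h (h^-1 u) y_h is an invariant of degree d + 1. Taking the coefficient
    of y_1 among the terms that are linear in the y_h obeys the product rule
    D(p q) = p0 D(q) + q0 D(p), where p0 is the restriction of p to V. If p is
    invariant, p0 is its constant term modulo I. So on an algebra generated by
    invariants of degree at most d, where D has values of degree less than d on
    the generators, the component of degree d of D stays in I. But D takes the
    invariant above to u.

    All suprema and infima in the statement thus range over sets of naturals
    bounded by |G|, where they are attained, and the equality between the two
    suprema follows from the inequalities at modules which attain them. *)

Set Implicit Arguments.
Unset Strict Implicit.
Unset Printing Implicit Defensive.

Import Order.TTheory GRing.Theory Num.Theory.

Local Open Scope classical_set_scope.
Local Open Scope quotient_scope.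
Local Open Scope ring_scope.

(** * Substitutions and homogeneous components *)

Section Substitution.

Variable R : comNzRingType.

Lemma comp_mpoly_comp n k l (p : {mpoly R[n]}) (s : n.-tuple {mpoly R[k]})
    (t : k.-tuple {mpoly R[l]}) :
  (p \mPo s) \mPo t = p \mPo [tuple tnth s i \mPo t | i < n].
Proof.
rewrite (comp_mpolyEX p s) (comp_mpolyEX p) raddf_sum /=; apply: eq_bigr => m _.
rewrite comp_mpolyZ !comp_mpolyX rmorph_prod /=; congr (_ *: _).
by apply: eq_bigr => i _; rewrite rmorphXn /= tnth_mktuple.
Qed.

Lemma comp_mpolyXi n k (s : n.-tuple {mpoly R[k]}) i : 'X_i \mPo s = tnth s i.
Proof. by rewrite comp_mpolyXU -tnth_nth. Qed.

Lemma dhomog_prodX n (s : seq 'I_n) :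
  \prod_(i <- s) 'X_i \is [in R[n], (size s).-homog].
Proof.
elim: s => [|i s IHs]; first by rewrite big_nil dhomog1.
by rewrite big_cons /= -add1n dhomogM // dhomogX /= mdeg1.
Qed.

(** A monomial as a list of variables: cutting the list cuts the monomial at a
    prescribed degree. *)
Lemma mpolyX_prodX n (m : 'X_{1..n}) :
  exists2 s : seq 'I_n, size s = mdeg m
    & 'X_[m] = \prod_(i <- s) 'X_i :> {mpoly R[n]}.
Proof.
elim: {m}(mdeg m) {-2}m (erefl (mdeg m)) => [|d IHd] m deg_m.
  move/eqP: deg_m; rewrite mdeg_eq0 => /eqP->.
  by exists [::]; rewrite ?mdeg0 // big_nil mpolyX0.
have [i m_i]: exists i, (U_(i) <= m)%MM.
  apply/existsP; rewrite -[X in is_true X]negbK negb_exists.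
  apply/negP => /forallP m0.
  move: deg_m; rewrite mdegE big1 // => i _; apply/eqP.
  by rewrite -[_ == _]negbK -lep1mP.
have deg_m' : mdeg (m - U_(i)) = d.
  by apply: succn_inj; rewrite -deg_m -{2}(submK m_i) mdegD mdeg1 addn1.
have [s size_s Xs] := IHd _ deg_m'.
exists (i :: s); first by rewrite /= size_s deg_m' deg_m.
by rewrite big_cons -Xs -mpolyXD addmC submK.
Qed.

Lemma pihomog_homogM n d e (h q : {mpoly R[n]}) : h \is e.-homog ->
  pihomog mdeg d (h * q) = if (e <= d)%N then h * pihomog mdeg (d - e) q else 0.
Proof.
move=> h_homog; rewrite [q]mpolyE mulr_sumr !raddf_sum /= mulr_sumr.
have mono m : pihomog mdeg d (h * 'X_[m]) =
    if (e <= d)%N then h * pihomog mdeg (d - e) 'X_[m] else 0.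
  have hm : h * 'X_[m] \is (e + mdeg m)%N.-homog by rewrite dhomogM ?dhomogX.
  rewrite pihomogX; have [<-|ne_d] := eqVneq (e + mdeg m)%N d.
    by rewrite pihomog_dE // leq_addr addKn eqxx.
  rewrite (pihomog_ne0 ne_d hm); case: leqP => // le_ed.
  by rewrite -(eqn_add2l e) subnKC // (negbTE ne_d) mulr0.
transitivity (\sum_(m <- msupp q) q@_m *: pihomog mdeg d (h * 'X_[m])).
  by apply: eq_bigr => m _; rewrite -scalerAr linearZ.
case: leqP => le_ed; last first.
  by apply: big1 => m _; rewrite mono leqNgt le_ed scaler0.
by apply: eq_bigr => m _; rewrite mono le_ed linearZ /= scalerAr.
Qed.

Lemma pihomog_comp n k d (p : {mpoly R[n]}) (s : n.-tuple {mpoly R[k]}) :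
    (forall i, tnth s i \is 1.-homog) ->
  pihomog mdeg d (p \mPo s) = pihomog mdeg d p \mPo s.
Proof.
move=> s1; elim/mpolyind: p => [|c m p _ _ IHp].
  by rewrite !(comp_mpoly0, pihomog0).
rewrite comp_mpolyD !pihomogD comp_mpolyD IHp; congr (_ + _).
rewrite comp_mpolyZ [LHS]linearZ /= [pihomog _ _ (_ *: _)]linearZ /=.
rewrite comp_mpolyZ.
congr (_ *: _).
have [t size_t ->] := mpolyX_prodX m; rewrite rmorph_prod /=.
have t_homog : \prod_(i <- t) ('X_i \mPo s) \is (size t).-homog.
  elim: t {size_t} => [|i t IHt]; first by rewrite big_nil dhomog1.
  by rewrite big_cons /= -add1n dhomogM // comp_mpolyXi.
have Xt := dhomog_prodX t.
have [eq_d|ne_d] := eqVneq (size t) d.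
  by rewrite -eq_d !pihomog_dE // rmorph_prod.
by rewrite (pihomog_ne0 ne_d t_homog) (pihomog_ne0 ne_d Xt) raddf0.
Qed.

Lemma dhomog_coeff0 n d (p : {mpoly R[n]}) :
  p \is d.-homog -> (0 < d)%N -> p@_0%MM = 0.
Proof.
move=> /dhomog_nemf_coeff p0 d_gt0; apply: p0.
by rewrite mf0 eq_sym -lt0n.
Qed.

Lemma pihomog0_coeff n (p : {mpoly R[n]}) : p@_0%MM = 0 -> pihomog mdeg 0 p = 0.
Proof.
move=> p0; rewrite pihomogE big1 // => m /eqP/eqP; rewrite mdeg_eq0 => /eqP->.
by rewrite p0 scale0r.
Qed.

End Substitution.

(** * Ideals spanned by a set *)

Section Spans.

Variable R : comNzRingType.

(** The existential formula is the one that defines the Hilbert ideal, for an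
    arbitrary set of generators. *)
Definition ideal_span (T : set R) : set R :=
  [set f | exists s : seq (R * R),
     (forall p, p \in s -> T p.1) /\ f = \sum_(p <- s) p.1 * p.2].

Variable T : set R.

Lemma ideal_span0 : ideal_span T 0.
Proof. by exists [::]; split=> //; rewrite big_nil. Qed.

Lemma ideal_span_gen h q : T h -> ideal_span T (h * q).
Proof.
move=> Th; exists [:: (h, q)]; split=> [p|]; last by rewrite big_seq1.
by rewrite inE => /eqP->.
Qed.

Lemma ideal_spanD f g :
  ideal_span T f -> ideal_span T g -> ideal_span T (f + g).
Proof.
move=> [s [Ts ->]] [t [Tt ->]]; exists (s ++ t); rewrite big_cat; split=> // p.
by rewrite mem_cat => /orP[/Ts|/Tt].
Qed.

Lemma ideal_spanMr f g : ideal_span T f -> ideal_span T (f * g).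
Proof.
move=> [s [Ts ->]]; exists [seq (p.1, p.2 * g) | p <- s]; split=> [p|].
  by case/mapP=> p' /Ts Tp' ->.
by rewrite big_map mulr_suml; apply: eq_bigr => p _; rewrite mulrA.
Qed.

Lemma ideal_span_sum (I : eqType) (r : seq I) (F : I -> R) :
  (forall i, i \in r -> ideal_span T (F i)) -> ideal_span T (\sum_(i <- r) F i).
Proof.
move=> TF; rewrite big_seq; apply: (big_ind (ideal_span T)) => //.
- exact: ideal_span0.
- exact: ideal_spanD.
Qed.

End Spans.

(** * The action of the group on polynomials and its invariants *)

Section Action.

Variables (F : fieldType) (gT : finGroupType) (G : {group gT}).
Variables (n : nat) (rG : mx_representation F G n).
Implicit Types (f h q : {mpoly F[n]}).

HB.instance Definition _ g := GRing.LRMorphism.copy (poly_act rG g)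
  (comp_mpoly [tuple \sum_(j < n) (rG g^-1%g i j *: 'X_j) | i < n]).

Lemma poly_actX g i :
  poly_act rG g 'X_i = \sum_(j < n) (rG g^-1%g i j *: 'X_j).
Proof. by rewrite /poly_act comp_mpolyXi tnth_mktuple. Qed.

Lemma poly_act1 f : poly_act rG 1 f = f.
Proof.
rewrite -[RHS]comp_mpoly_id; congr (_ \mPo _); apply: eq_from_tnth => i.
rewrite !tnth_mktuple invg1 repr_mx1 (bigD1 i) //= big1 ?addr0.
  by rewrite mxE eqxx scale1r.
by move=> j ne_ji; rewrite mxE eq_sym (negbTE ne_ji) scale0r.
Qed.

Lemma poly_actM (x y : gT) f : x \in G -> y \in G ->
  poly_act rG x (poly_act rG y f) = poly_act rG (x * y) f.
Proof.
move=> Gx Gy; rewrite [LHS]comp_mpoly_comp; congr (_ \mPo _).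
apply: eq_from_tnth => i; rewrite !tnth_mktuple raddf_sum /=.
under eq_bigr => j _ do
  rewrite comp_mpolyZ comp_mpolyXi tnth_mktuple scaler_sumr.
rewrite exchange_big /= invMg repr_mxM ?groupV //; apply: eq_bigr => k _.
by rewrite mxE scaler_suml; apply: eq_bigr => j _; rewrite scalerA.
Qed.

Lemma linear_form_homog (c : 'I_n -> F) :
  \sum_(j < n) (c j *: 'X_j) \is [in F[n], 1.-homog].
Proof. by apply: rpred_sum => j _; rewrite rpredZ // dhomogX /= mdeg1. Qed.

Lemma pihomog_act d g f :
  pihomog mdeg d (poly_act rG g f) = poly_act rG g (pihomog mdeg d f).
Proof.
by apply: pihomog_comp => i; rewrite tnth_mktuple linear_form_homog.
Qed.

Lemma coeff0_act g f : f@_0%MM = 0 -> (poly_act rG g f)@_0%MM = 0.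
Proof.
move=> f0; rewrite /poly_act comp_mpolyEX raddf_sum big_seq big1 //= => m m_f.
rewrite mcoeffZ; have [t size_t ->] := mpolyX_prodX F m.
rewrite rmorph_prod rmorph_prod /=; case: t size_t => [|i t] deg_m.
  move/esym/eqP: deg_m; rewrite mdeg_eq0 => /eqP m0.
  by move: m_f; rewrite m0 mcoeff_msupp f0 eqxx.
rewrite big_cons comp_mpolyXi tnth_mktuple.
by rewrite (dhomog_coeff0 (linear_form_homog _)) // mul0r mulr0.
Qed.

Lemma invariants_subalg : GRing.subalg_closed (mem (invariants rG)).
Proof.
split=> [|a f h|f h]; rewrite !inE.
- by move=> g Gg; rewrite rmorph1.
- by move=> fI hI g Gg; rewrite linearP /= fI // hI.
- by move=> fI hI g Gg; rewrite rmorphM /= fI // hI.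
Qed.

(** The action is by linear substitutions, so it commutes with taking
    homogeneous components. *)
Lemma invariants_pihomog d f :
  invariants rG f -> invariants rG (pihomog mdeg d f).
Proof. by move=> fI g Gg; rewrite -pihomog_act fI. Qed.

Lemma orbit_sum_invariant f :
  invariants rG (\sum_(g in G) poly_act rG g f).
Proof.
move=> x Gx; rewrite raddf_sum /= [RHS](reindex_inj (mulgI x)) /=.
apply: eq_big => [g|g Gg]; first by rewrite groupMl.
by rewrite poly_actM.
Qed.

(** * Homogeneous generators of the Hilbert ideal *)

Local Notation I := (hilbert_ideal rG).

Lemma hilbert_idealP f :
  reflect (ideal_span (invariants_pos rG) f) (f \in I).
Proof. exact: asboolP. Qed.

Lemma hilbert_ideal_inv h q : invariants_pos rG h -> h * q \in I.
Proof. by move=> hI; apply/hilbert_idealP/ideal_span_gen. Qed.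

(** Degree 0 is excluded so that constant terms vanish; the bound b records in
    which degrees generators suffice. *)
Definition homog_invariants b : set {mpoly F[n]} :=
  [set h | invariants rG h /\ exists2 e, (0 < e <= b)%N & h \is e.-homog].

(** The component of degree d of h q is the sum over e of h_e q_(d-e), and the
    invariants h_e with e > d do not occur in it. *)
Lemma hilbert_ideal_homog_span d f :
  f \in I -> ideal_span (homog_invariants d) (pihomog mdeg d f).
Proof.
case/hilbert_idealP=> s [s_inv ->]; rewrite raddf_sum /=.
apply: ideal_span_sum => p /s_inv[p_inv p0].
rewrite [p.1](pihomog_partitionE (leqnn (msize p.1))) mulr_suml raddf_sum /=.
apply: ideal_span_sum => e _; rewrite (pihomog_homogM _ _ (pihomogP _ e _)).
case: leqP => [le_ed|_]; last exact: ideal_span0.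
have [e0|e_gt0] := posnP e.
  by rewrite e0 pihomog0_coeff // mul0r; apply: ideal_span0.
apply: ideal_span_gen; split; first exact: invariants_pihomog.
by exists e; rewrite ?e_gt0 // pihomogP.
Qed.

Lemma homog_span_hilbert b f : ideal_span (homog_invariants b) f -> f \in I.
Proof.
case=> s [s_inv ->]; rewrite big_seq; apply: rpred_sum => p /s_inv[p_inv].
case=> e /andP[e_gt0 _] pe.
by apply: hilbert_ideal_inv; split=> //; apply: dhomog_coeff0 pe _.
Qed.

Lemma hilbert_ideal_pihomog d f : f \in I -> pihomog mdeg d f \in I.
Proof. by move/(hilbert_ideal_homog_span d)/homog_span_hilbert. Qed.

(** Every monomial of degree at least b has a factor of degree b, which is in I
    and hence spanned by homogeneous invariants of degree at most b. *)
Lemma homog_span_ge b d f :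
    (forall q, q \is b.-homog -> q \in I) -> (b <= d)%N -> f \is d.-homog ->
  ideal_span (homog_invariants b) f.
Proof.
move=> Ib le_bd /dhomogP f_d; rewrite [f]mpolyE.
apply: ideal_span_sum => m /f_d deg_m.
have [s size_s ->] := mpolyX_prodX F m.
rewrite -(cat_take_drop b s) big_cat /= scalerAr.
have Xb : \prod_(i <- take b s) 'X_i \is [in F[n], b.-homog].
  by have := dhomog_prodX F (take b s); rewrite size_takel // size_s deg_m.
apply: ideal_spanMr; rewrite -(pihomog_dE Xb).
exact/hilbert_ideal_homog_span/Ib.
Qed.

Lemma hilbert_ideal_ge b d f :
    (forall q, q \is b.-homog -> q \in I) -> (b <= d)%N -> f \is d.-homog ->
  f \in I.
Proof. by move=> Ib le_bd /(homog_span_ge Ib le_bd)/homog_span_hilbert. Qed.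

(** * The Noether bound for the coinvariants *)

Section Nonmodular.

Hypothesis G_neq0 : #|G|%:R != 0 :> F.

(** Expand one factor f - (t x) f at a time. The part with (t x) f is the sum
    for the shorter list and the polynomial b = a (x f) in place of a; as b has
    no constant term, its orbit sum is in I. The statement carries an arbitrary a
    to make this induction possible. *)
Lemma telescope_hilbert_ideal (s : seq (gT * {mpoly F[n]})) a :
    (forall p, p \in s -> p.1 \in G /\ p.2@_0%MM = 0) ->
  \sum_(t in G) poly_act rG t a *
      \prod_(p <- s) (p.2 - poly_act rG (t * p.1) p.2)
    - (\sum_(t in G) poly_act rG t a) * \prod_(p <- s) p.2 \in I.
Proof.
elim: s a => [|[x f] s IHs] a s_ok.
  rewrite big_nil mulr1; under eq_bigr => t _ do rewrite big_nil mulr1.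
  by rewrite subrr rpred0.
have [Gx f0]: x \in G /\ f@_0%MM = 0 by apply: (s_ok (x, f)); rewrite mem_head.
have s_ok' p : p \in s -> p.1 \in G /\ p.2@_0%MM = 0.
  by move=> s_p; apply: s_ok; rewrite inE s_p orbT.
pose P t := \prod_(p <- s) (p.2 - poly_act rG (t * p.1) p.2).
pose Q := \prod_(p <- s) p.2.
pose b := a * poly_act rG x f.
have b_inv : invariants_pos rG (\sum_(t in G) poly_act rG t b).
  split; first exact: orbit_sum_invariant.
  rewrite raddf_sum big1 //= => t _; apply: coeff0_act.
  by rewrite rmorphM /= (coeff0_act x f0) mulr0.
suff ->: \sum_(t in G) poly_act rG t a *
      \prod_(p <- (x, f) :: s) (p.2 - poly_act rG (t * p.1) p.2)
    - (\sum_(t in G) poly_act rG t a) * \prod_(p <- (x, f) :: s) p.2 =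
    f * (\sum_(t in G) poly_act rG t a * P t
           - (\sum_(t in G) poly_act rG t a) * Q)
    - (\sum_(t in G) poly_act rG t b * P t
         - (\sum_(t in G) poly_act rG t b) * Q)
    - (\sum_(t in G) poly_act rG t b) * Q.
  apply: rpredB; last exact: hilbert_ideal_inv.
  by apply: rpredB; [apply: idealMr|]; apply: IHs.
rewrite -[RHS]addrA -opprD subrK big_cons -/Q /= mulrBr.
rewrite [f * (_ * Q)]mulrCA addrAC; congr (_ - _).
rewrite mulr_sumr -sumrB; apply: eq_bigr => t Gt; rewrite big_cons /= -/(P t).
rewrite /b rmorphM /= poly_actM // mulrBl mulrBr mulrCA.
by congr (_ - _); apply: mulrA.
Qed.

(** Once every element of G is paired with a member of s, the left sum of
    [telescope_hilbert_ideal] vanishes term by term, and what remains for a = 1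
    is - |G| times the product. *)
Lemma prod_hilbert_ideal (s : seq {mpoly F[n]}) :
    size s = #|G| -> (forall f, f \in s -> f@_0%MM = 0) ->
  \prod_(f <- s) f \in I.
Proof.
move=> size_s s0; pose r := zip (enum G) s.
have size_G : size (enum G) = size s by rewrite -cardE.
have r_ok p : p \in r -> p.1 \in G /\ p.2@_0%MM = 0.
  move=> r_p; split; last first.
    by apply: s0; rewrite -(@unzip2_zip _ _ (enum G) s) ?size_G ?map_f.
  by rewrite -mem_enum -(@unzip1_zip _ _ (enum G) s) ?size_G ?map_f.
have prod_r : \prod_(p <- r) p.2 = \prod_(f <- s) f.
  by rewrite -[in RHS](@unzip2_zip _ _ (enum G) s) ?size_G // big_map.
have := telescope_hilbert_ideal 1 r_ok; rewrite prod_r big1 => [|t Gt].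
  rewrite [X in X * _](eq_bigr (fun=> 1)) => [|t _]; last exact: rmorph1.
  rewrite sub0r rpredN sumr_const mulr_natl -scaler_nat => Gs.
  rewrite -[\prod_(f <- s) f](scalerK G_neq0) -mul_mpolyC.
  exact: idealMr.
(* The factor of the pair p with p.1 = t^-1 is p.2 - 1 p.2 = 0. *)
have /mapP[p r_p t_p] : t^-1%g \in unzip1 r.
  by rewrite unzip1_zip ?size_G // mem_enum groupV.
by rewrite (big_rem p) //= -t_p mulgV poly_act1 subrr mul0r mulr0.
Qed.

Lemma hilbert_ideal_Noether d f :
  (#|G| <= d)%N -> f \is d.-homog -> f \in I.
Proof.
apply: hilbert_ideal_ge => q /dhomogP q_G; rewrite [q]mpolyE big_seq.
apply: rpred_sum => m /q_G deg_m; rewrite -mul_mpolyC idealMr //.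
have [s size_s ->] := mpolyX_prodX F m.
rewrite -[\prod_(i <- s) _](big_map (fun i => 'X_i) xpredT id).
apply: prod_hilbert_ideal => [|_ /mapP[i _ ->]].
  by rewrite size_map size_s.
by apply: (@dhomog_coeff0 _ _ 1) => //; rewrite dhomogX /= mdeg1.
Qed.

(** * Generation of the invariants *)

Definition reynolds f := #|G|%:R^-1 *: \sum_(g in G) poly_act rG g f.

Lemma reynolds_invariant f : invariants rG (reynolds f).
Proof. by move=> g Gg; rewrite linearZ /= orbit_sum_invariant. Qed.

(** The Reynolds operator fixes f and is linear over the invariants. *)
Lemma reynolds_span f (s : seq ({mpoly F[n]} * {mpoly F[n]})) :
    invariants rG f -> (forall p, p \in s -> invariants rG p.1) ->
  f = \sum_(p <- s) p.1 * p.2 -> f = \sum_(p <- s) p.1 * reynolds p.2.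
Proof.
move=> f_inv s_inv f_s; apply: (scalerI G_neq0).
transitivity (\sum_(g in G) poly_act rG g f).
  by under eq_bigr => g Gg do rewrite f_inv //; rewrite sumr_const scaler_nat.
rewrite f_s; under [LHS]eq_bigr => g Gg do rewrite raddf_sum.
rewrite exchange_big scaler_sumr /= big_seq [RHS]big_seq.
apply: eq_bigr => p s_p.
rewrite scalerAr scalerA mulfV // scale1r mulr_sumr; apply: eq_bigr => g Gg.
by rewrite rmorphM /= s_inv.
Qed.

Lemma subalg_gen_subalg (S : set {mpoly F[n]}) :
  GRing.subalg_closed (mem (subalg_gen S)).
Proof.
split=> [|a f h|f h]; rewrite !inE.
- by move=> A [[A1 _ _] _]; move: A1; rewrite inE.
- move=> Sf Sh A SA; have [[_ Alin _] _] := SA.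
  by have := Alin a f h; rewrite !inE; apply; [apply: Sf|apply: Sh].
- move=> Sf Sh A SA; have [[_ _ AM] _] := SA.
  by have := AM f h; rewrite !inE; apply; [apply: Sf|apply: Sh].
Qed.

Lemma subalg_gen_sum (S : set {mpoly F[n]}) (J : eqType) (r : seq J) E :
    (forall i, i \in r -> subalg_gen S (E i)) ->
  subalg_gen S (\sum_(i <- r) E i).
Proof.
have [S1 lin _] := subalg_gen_subalg S => SE; rewrite big_seq.
have S0 : subalg_gen S 0.
  by have := lin (-1) 1 1 S1 S1; rewrite scaleN1r addNr inE.
apply: (big_ind (subalg_gen S)) => // f h Sf Sh.
by have := lin 1 f h; rewrite !inE scale1r; apply.
Qed.

(** Induction on the degree d of a homogeneous invariant f: for d > b, f is a
    combination of invariants of degrees e with 0 < e <= b, whose coefficients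
    can be replaced by invariants, of degrees d - e < d. *)
Lemma generated_in_degree_hilbert b :
  (forall q, q \is b.-homog -> q \in I) -> generated_in_degree rG b.
Proof.
move=> Ib; rewrite /generated_in_degree; set S := (X in subalg_gen X).
apply/seteqP; split.
  by apply: smallest_sub; [apply: invariants_subalg|move=> f []].
have S_sub : S `<=` subalg_gen S by apply: sub_gen_smallest.
move=> f f_inv; rewrite (pihomog_partitionE (leqnn (msize f))).
apply: subalg_gen_sum => d _; move: (nat_of_ord d) => {}d.
elim/ltn_ind: d f f_inv => d IHd f /(@invariants_pihomog d).
move: (pihomogP mdeg d f); move: (pihomog mdeg d f) => {}f f_d f_inv.
have [le_db|lt_bd] := leqP d b.
  apply: S_sub; split=> //; apply: (@leq_trans d.+1) => //.
  by rewrite msizeE; apply/bigmax_leqP_seq => m /(dhomogP _ _ _ f_d)->.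
have [s [s_inv f_s]] := homog_span_ge Ib (ltnW lt_bd) f_d.
have {}f_s : f = _ := reynolds_span f_inv (fun p s_p => (s_inv p s_p).1) f_s.
rewrite -(pihomog_dE f_d) {}f_s raddf_sum /=.
apply: subalg_gen_sum => p /s_inv[p_inv [e /andP[e_gt0 le_eb] p_e]].
rewrite (pihomog_homogM _ _ p_e) (leq_trans le_eb (ltnW lt_bd)).
have [_ _ mul] := subalg_gen_subalg S.
have := mul p.1 (pihomog mdeg (d - e) (reynolds p.2)); rewrite !inE; apply.
  apply: S_sub; split=> //; apply: (@leq_trans e.+1) => //.
  by rewrite msizeE; apply/bigmax_leqP_seq => m /(dhomogP _ _ _ p_e)->.
apply: IHd; last exact: reynolds_invariant.
by rewrite ltn_subrL e_gt0 (leq_ltn_trans _ lt_bd).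
Qed.

End Nonmodular.

End Action.

(** * Adding the regular representation *)

Section DirectSum.

Variables (F : fieldType) (gT : finGroupType) (G : {group gT}).

Lemma dsum_mx_repr n1 n2 (rG1 : mx_representation F G n1)
    (rG2 : mx_representation F G n2) :
  mx_repr G (fun g => block_mx (rG1 g) 0 0 (rG2 g)).
Proof.
split=> [|x y Gx Gy]; first by rewrite !repr_mx1 -scalar_mx_block.
by rewrite mulmx_block !(mulmx0, mul0mx, addr0, add0r) !repr_mxM.
Qed.

Variables (n : nat) (rG : mx_representation F G n).
Local Notation N := (gcard G).
Local Notation I := (hilbert_ideal rG).

(** G permutes the added coordinates simply transitively, so any polynomial on V
    is the coefficient of one of them in an invariant. *)
Definition regular_ext : mx_representation F G (n + N) :=
  MxRepresentation (dsum_mx_repr rG (regular_repr F G)).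

(** Composition with [ext_embed] regards a function on V as a function on the
    direct sum, and composition with [ext_restrict] is the restriction of
    functions to V. *)
Definition ext_embed : n.-tuple {mpoly F[n + N]} :=
  [tuple 'X_(lshift N i) | i < n].

Definition ext_restrict : (n + N).-tuple {mpoly F[n]} :=
  [tuple match split i with inl j => 'X_j | inr _ => 0 end | i < n + N].

Lemma restrictXl i : 'X_(lshift N i) \mPo ext_restrict = 'X_i.
Proof. by rewrite comp_mpolyXi tnth_mktuple (unsplitK (inl i)). Qed.

Lemma restrictXr j : 'X_(rshift n j) \mPo ext_restrict = 0.
Proof. by rewrite comp_mpolyXi tnth_mktuple (unsplitK (inr j)). Qed.

Lemma ext_embedK p : (p \mPo ext_embed) \mPo ext_restrict = p.
Proof.
rewrite comp_mpoly_comp -[RHS]comp_mpoly_id; congr (_ \mPo _).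
by apply: eq_from_tnth => i; rewrite !tnth_mktuple restrictXl.
Qed.

Lemma ext_actXl g i : poly_act regular_ext g 'X_(lshift N i) =
  \sum_(j < n) rG g^-1%g i j *: 'X_(lshift N j).
Proof.
rewrite poly_actX big_split_ord /= [X in _ + X]big1 ?addr0 => [|j _].
  by apply: eq_bigr => j _; rewrite block_mxEul.
by rewrite block_mxEur mxE scale0r.
Qed.

Lemma ext_actXr g i : poly_act regular_ext g 'X_(rshift n i) =
  \sum_(j < N) regular_mx F G g^-1%g i j *: 'X_(rshift n j).
Proof.
rewrite poly_actX big_split_ord /= [X in X + _]big1 ?add0r => [|j _].
  by apply: eq_bigr => j _; rewrite block_mxEdr.
by rewrite block_mxEdl mxE scale0r.
Qed.

Lemma ext_embed_act g p :
  poly_act rG g p \mPo ext_embed = poly_act regular_ext g (p \mPo ext_embed).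
Proof.
rewrite /poly_act !comp_mpoly_comp; congr (_ \mPo _).
apply: eq_from_tnth => i; rewrite !tnth_mktuple.
rewrite -/(poly_act regular_ext g _) ext_actXl raddf_sum /=.
by apply: eq_bigr => j _; rewrite comp_mpolyZ comp_mpolyXi tnth_mktuple.
Qed.

Lemma ext_restrict_act g p :
  poly_act regular_ext g p \mPo ext_restrict
  = poly_act rG g (p \mPo ext_restrict).
Proof.
rewrite /poly_act !comp_mpoly_comp; congr (_ \mPo _).
apply: eq_from_tnth => i; rewrite !tnth_mktuple -poly_actX.
rewrite -/(poly_act rG g _) -[i]splitK; case: (split i) => j /=.
  rewrite (unsplitK (inl j)) ext_actXl poly_actX raddf_sum /=.
  by apply: eq_bigr => k _; rewrite comp_mpolyZ restrictXl.
rewrite (unsplitK (inr j)) ext_actXr raddf0 raddf_sum big1 //= => k _.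
by rewrite comp_mpolyZ restrictXr scaler0.
Qed.

Definition regular_var h : {mpoly F[n + N]} := 'X_(rshift n (gring_index G h)).

Lemma regular_var_act g h : g \in G -> h \in G ->
  poly_act regular_ext g (regular_var h) = regular_var (h * g^-1).
Proof.
move=> Gg Gh; rewrite ext_actXr (bigD1 (gring_index G (h * g^-1))) //= big1.
  by rewrite addr0 !mxE gring_indexK // !eqxx scale1r.
by move=> j ne_j; rewrite !mxE gring_indexK // (negbTE ne_j) andbF scale0r.
Qed.

(** An element g takes both h^-1 u and the coordinate y_h = [regular_var h] to
    those of h g^-1, so it permutes the summands. *)
Definition ext_witness u : {mpoly F[n + N]} :=
  \sum_(h in G) (poly_act rG h^-1 u \mPo ext_embed) * regular_var h.

Lemma ext_witness_invariant u : invariants regular_ext (ext_witness u).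
Proof.
move=> g Gg; rewrite /ext_witness raddf_sum /=.
rewrite [RHS](reindex_inj (mulIg g^-1)%g) /=.
apply: eq_big => [h|h Gh]; first by rewrite groupMr ?groupV.
rewrite rmorphM /= regular_var_act //; congr (_ * _).
rewrite -(ext_embed_act g (poly_act rG h^-1 u)); congr (_ \mPo _).
by rewrite poly_actM ?groupV // invMg invgK.
Qed.

(** The derivative in y_1 at y = 0 is the coefficient of y_1 in the part of p
    that is linear in the coordinates y_h. *)
Definition linear_part (p : {mpoly F[n + N]}) : {mpoly F[n]} :=
  p^`M(rshift n (gring_index G 1)) \mPo ext_restrict.

Lemma linear_partM p q : linear_part (p * q) =
  (p \mPo ext_restrict) * linear_part q + (q \mPo ext_restrict) * linear_part p.
Proof.
rewrite /linear_part mderivM comp_mpolyD !rmorphM /= addrC; congr (_ + _).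
exact: mulrC.
Qed.

Lemma linear_part_witness u : linear_part (ext_witness u) = u.
Proof.
have varM p h : linear_part (p * regular_var h) =
    (p \mPo ext_restrict) * linear_part (regular_var h).
  by rewrite linear_partM [regular_var h \mPo _]restrictXr mul0r addr0.
have var_part h : h \in G -> linear_part (regular_var h) = (h == 1%g)%:R.
  move=> Gh; rewrite /linear_part mderivX mnm1E eq_rshift.
  rewrite (inj_in_eq (can_in_inj (@gring_indexK _ G))) //.
  case: eqP => [->|_]; last by rewrite scale0r raddf0.
  by rewrite scale1r -{1}[U_(_)%MM]add0m addmK mpolyX0 rmorph1.
transitivity (\sum_(h in G)
    linear_part ((poly_act rG h^-1 u \mPo ext_embed) * regular_var h)).
  rewrite /linear_part /ext_witness (raddf_sum (mderiv _)).
  exact: raddf_sum.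
rewrite (bigD1 1%g) //= big1 => [|h /andP[Gh /negbTE ne_h1]].
  by rewrite varM var_part // eqxx mulr1 addr0 ext_embedK invg1 poly_act1.
by rewrite varM var_part // ne_h1 mulr0.
Qed.

(** Deriving with respect to y_1 lowers the degree by one. *)
Lemma linear_part_degree d p :
  (msize p <= d.+1)%N -> pihomog mdeg d (linear_part p) = 0.
Proof.
move=> p_d; rewrite /linear_part pihomog_comp => [|i].
  rewrite pihomogE big1 ?raddf0 // => m /eqP deg_m; rewrite mcoeff_mderiv.
  rewrite memN_msupp_eq0 ?mul0rn ?scale0r //.
  by apply: msize_mdeg_ge; rewrite mdegD mdeg1 deg_m addn1.
rewrite tnth_mktuple; case: (split i) => j; last exact: rpred0.
by rewrite dhomogX /= mdeg1.
Qed.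

(** The invariant a is the sum of its constant term and an element of I, and I
    contains the homogeneous components of its elements. *)
Lemma hilbert_ideal_invM d a q : invariants rG a ->
  pihomog mdeg d q \in I -> pihomog mdeg d (a * q) \in I.
Proof.
move=> a_inv Iq.
rewrite -[a](subrK (a@_0%MM)%:MP) mulrDl pihomogD rpredD //; last first.
  by rewrite mul_mpolyC linearZ /= -mul_mpolyC idealMr.
apply/hilbert_ideal_pihomog/hilbert_ideal_inv; split.
  by move=> g Gg; rewrite raddfB /= a_inv // /poly_act comp_mpolyC.
by rewrite mcoeffB mcoeffC eqxx mulr1 subrr.
Qed.

(** The polynomials p on the direct sum whose restriction to V is invariant and
    whose coefficient of y_1 has its component of degree d in I form an algebra,
    by the product rule and [hilbert_ideal_invM]. It contains the invariants of
    degree at most d, but not the witness, whose coefficient of y_1 is u. *)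
Lemma generated_in_degree_ext b d u :
    u \is d.-homog -> u \notin I -> generated_in_degree regular_ext b ->
  (d < b)%N.
Proof.
move=> u_d u_I gen_b; rewrite ltnNge; apply: contraNN u_I => le_bd.
pose A := [set p : {mpoly F[n + N]} | invariants rG (p \mPo ext_restrict)
  /\ pihomog mdeg d (linear_part p) \in I].
suff [_]: A (ext_witness u) by rewrite linear_part_witness pihomog_dE.
have := ext_witness_invariant u; rewrite -gen_b.
apply: smallest_sub; last first.
  move=> p [p_inv p_b]; split=> [g Gg|].
    by rewrite -ext_restrict_act p_inv.
  by rewrite linear_part_degree ?rpred0 // (leq_trans p_b).
have [inv1 inv_lin inv_mul] := invariants_subalg rG.
split=> [|c p q /set_mem[p_inv Ip] /set_mem[q_inv Iq]|];
  last move=> p q /set_mem[p_inv Ip] /set_mem[q_inv Iq].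
- apply/mem_set; split; first by rewrite rmorph1; move: inv1; rewrite inE.
  by rewrite /linear_part -mpolyC1 mderivC !raddf0 rpred0.
- apply/mem_set; split.
    have := inv_lin c _ _ (mem_set p_inv) (mem_set q_inv).
    by rewrite inE linearP.
  by rewrite /linear_part !linearP /= rpredD // -mul_mpolyC idealMr.
- apply/mem_set; split.
    have := inv_mul _ _ (mem_set p_inv) (mem_set q_inv).
    by rewrite inE rmorphM.
  by rewrite linear_partM pihomogD rpredD // hilbert_ideal_invM.
Qed.

End DirectSum.

(** * Attained suprema and infima of naturals *)

Lemma lee_nat (m k : nat) : (m%:Z%:E <= k%:Z%:E)%E = (m <= k)%N.
Proof. by rewrite lee_fin lez_nat. Qed.

Lemma supremum_max (x0 x : \bar int) (A : set (\bar int)) :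
  A x -> ubound A x -> supremum x0 A = x.
Proof.
move=> Ax ubx; rewrite /supremum ifF; last first.
  by apply/negbTE/set0P; exists x.
have supx : supremums A x by split=> // y; apply.
exact: (is_subset1_supremums (xgetPex _ (ex_intro _ x supx)) supx).
Qed.

Lemma infimum_min (x0 x : \bar int) (A : set (\bar int)) :
  A x -> lbound A x -> infimum x0 A = x.
Proof.
move=> Ax lbx; rewrite /infimum ifF; last first.
  by apply/negbTE/set0P; exists x.
have infx : infimums A x by split=> // y; apply.
exact: (is_subset1_infimums (xgetPex _ (ex_intro _ x infx)) infx).
Qed.

Lemma supremum_nat (x0 : \bar int) (N : nat) (A : set (\bar int)) :
    A !=set0 -> (forall x, A x -> exists2 k, (k <= N)%N & x = k%:Z%:E) ->
  exists k : nat, [/\ A k%:Z%:E, ubound A k%:Z%:E & supremum x0 A = k%:Z%:E].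
Proof.
move=> [x Ax] AN.
have exP : exists k, `[< A k%:Z%:E >].
  by have [k _ xk] := AN x Ax; exists k; apply/asboolP; rewrite -xk.
have bndP k : `[< A k%:Z%:E >] -> (k <= N)%N.
  by move/asboolP/AN => [j le_jN [->]].
have [k /asboolP Ak maxk] := ex_maxnP exP bndP; exists k.
have ubk : ubound A k%:Z%:E.
  move=> y Ay; have [j _ yj] := AN y Ay; rewrite yj lee_nat; apply: maxk.
  by apply/asboolP; rewrite -yj.
by split=> //; apply: supremum_max.
Qed.

(** * Comparison of the numerical invariants *)

Section Degrees.

Variables (F : fieldType) (gT : finGroupType) (G : {group gT}).
Hypothesis G_neq0 : #|G|%:R != 0 :> F.

Section Module.

Variables (n : nat) (rG : mx_representation F G n).
Local Notation I := (hilbert_ideal rG).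

Lemma noether_number_attained b : generated_in_degree rG b ->
  exists m : nat, [/\ noether_number rG = m%:Z%:E, generated_in_degree rG m
    & forall k, generated_in_degree rG k -> (m <= k)%N].
Proof.
move=> gen_b; have exP : exists k, `[< generated_in_degree rG k >].
  by exists b; apply/asboolP.
have [m /asboolP gen_m minm] := ex_minnP exP; exists m.
have {}minm k : generated_in_degree rG k -> (m <= k)%N.
  by move=> gen_k; apply/minm/asboolP.
split=> //; apply: infimum_min; first by exists m.
by move=> _ [k /minm le_mk <-]; rewrite lee_nat.
Qed.

Lemma coinvariant_eq0 f : (\pi_(coinvariants rG) f == 0) = (f \in I).
Proof.
rewrite -[f in RHS]subr0 Quotient.idealrBE.
by rewrite -(rmorph0 (\pi_(coinvariants rG))) eqquotE.
Qed.

(** Degree 0 occurs because 1 is not in I, and degrees from |G| on do not, so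
    there is a largest degree. *)
Lemma topdeg_attained : exists d : nat,
  [/\ topdeg rG = d%:Z%:E, (d < #|G|)%N,
      exists2 f, f \is d.-homog & f \notin I
    & forall f, f \is d.+1.-homog -> f \in I].
Proof.
pose A := [set d : nat |
  exists2 x, @coinvariants_homog _ _ _ _ rG d x & x != 0].
have AP d : A d <-> exists2 f, f \is d.-homog & f \notin I.
  split=> [[_ [f f_d <-] f_I]|[f f_d f_I]].
    by exists f; rewrite // -coinvariant_eq0.
  by exists (\pi_(coinvariants rG) f); [exists f|rewrite coinvariant_eq0].
have ltG d : A d -> (d < #|G|)%N.
  case/AP=> f f_d; rewrite ltnNge; apply: contraNN => le_Gd.
  exact: hilbert_ideal_Noether le_Gd f_d.
have [||d [[d' Ad' [eq_d]] ubd supd]] :=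
    @supremum_nat -oo%E #|G| [set d%:Z%:E | d in A].
- exists 0%:E, 0%N => //; apply/AP; exists 1; first exact: dhomog1.
  by rewrite idealr1.
- by move=> _ [d /ltG/ltnW le_dG <-]; exists d.
move: Ad'; rewrite eq_d => Ad.
exists d; split=> //; [exact: ltG|exact/AP|].
move=> f f_d; apply: contraT => f_I.
have /ubd: [set d%:Z%:E | d in A] d.+1%:Z%:E.
  by exists d.+1 => //; apply/AP; exists f.
by rewrite lee_nat ltnn.
Qed.

End Module.

(** All the degrees being natural numbers, the estimates become inequalities
    between naturals; k shows that the group Noether number exceeds d. *)
Lemma topdeg_noether_attained n (rG : mx_representation F G n) :
  exists d m : nat, [/\ topdeg rG = d%:Z%:E, noether_number rG = m%:Z%:E,
    (m <= d.+1 <= #|G|)%N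
    & exists2 k : nat, (d < k <= #|G|)%N
        & noether_number (regular_ext rG) = k%:Z%:E].
Proof.
have bound n' (rG' : mx_representation F G n') : exists d m : nat,
    [/\ topdeg rG' = d%:Z%:E, noether_number rG' = m%:Z%:E,
        (m <= d.+1 <= #|G|)%N, generated_in_degree rG' m
      & exists2 f, f \is d.-homog & f \notin hilbert_ideal rG'].
  have [d [top_d lt_dG ex_f Id]] := topdeg_attained rG'.
  have gen_d := generated_in_degree_hilbert G_neq0 Id.
  have [m [noe_m gen_m min_m]] := noether_number_attained gen_d.
  by exists d, m; rewrite min_m.
have [d [m [top_d noe_m le_m _ [f f_d f_I]]]] := bound _ rG.
have [d' [k [_ noe_k /andP[le_kd' le_d'G] gen_k _]]] :=
  bound _ (regular_ext rG).
exists d, m; split=> //; exists k => //.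
by rewrite (generated_in_degree_ext f_d f_I gen_k) (leq_trans le_kd').
Qed.

End Degrees.

Local Open Scope ereal_scope.

Theorem theorem1 (F : fieldType) (gT : finGroupType) (G : {group gT})
    (charF : forall p : nat, p \in [pchar F] -> ~~ (p %| #|G|)%N) :
  (forall (n : nat) (rG : mx_representation F G n),
     [/\ noether_number rG <= topdeg rG + 1,
         topdeg rG + 1 <= group_noether_number F G
       & group_noether_number F G <= #|G|%:Z%:E])
  /\ group_topdeg F G + 1 = group_noether_number F G.
Proof.
have G_neq0 : #|G|%:R != 0%R :> F.
  apply/negP => G0; have [p charFp] := natf0_pchar (cardG_gt0 G) G0.
  by have := charF p charFp; rewrite (dvdn_pcharf charFp) G0.
have attained := topdeg_noether_attained G_neq0.
have addE1 (d : nat) : d%:Z%:E + 1 = d.+1%:Z%:E.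
  by rewrite -[1]/(1%:Z%:E) -EFinD -PoszD addn1.
have [|x [n [rG ->]]|b [[n [rG noe_b]] ub_b sup_b]] :=
    @supremum_nat -oo #|G| [set x | exists n (rG : mx_representation F G n),
      x = noether_number rG].
- by exists (noether_number (regular_repr F G)), _, (regular_repr F G).
- have [d [m [_ -> /andP[le_md le_dG] _]]] := attained n rG.
  by exists m => //; apply: leq_trans le_dG.
have [|x [n' [rG' ->]]|t [[n' [rG' top_t]] ub_t sup_t]] :=
    @supremum_nat -oo #|G| [set x | exists n (rG : mx_representation F G n),
      x = topdeg rG].
- by exists (topdeg (regular_repr F G)), _, (regular_repr F G).
- have [d [m [-> _ /andP[_ le_dG] _]]] := attained n' rG'.
  by exists d => //; apply: ltnW.
have le_b d n0 (rG0 : mx_representation F G n0) :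
    topdeg rG0 = d%:Z%:E -> (d < b)%N.
  move=> top_d.
  have [d' [m [top_d' _ _ [k /andP[lt_dk _] noe_k]]]] := attained _ rG0.
  move: top_d'; rewrite top_d => -[eq_d]; rewrite eq_d.
  apply: leq_trans lt_dk _; rewrite -lee_nat -noe_k.
  by apply: ub_b; exists _, (regular_ext rG0).
rewrite /group_noether_number sup_b /group_topdeg sup_t addE1; split.
  move=> n0 rG0.
  have [d [m [top_d noe_m /andP[le_md _] _]]] := attained _ rG0.
  rewrite top_d noe_m addE1 !lee_nat le_md (le_b _ _ _ top_d); split=> //.
  have [d' [m' [_ noe_m' /andP[le_m' le_d'] _]]] := attained _ rG.
  by move: noe_b; rewrite noe_m' => -[->]; apply: leq_trans le_d'.
have lt_tb : (t < b)%N by apply: le_b (esym top_t).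
have [d [m [top_d noe_m /andP[le_md _] _]]] := attained _ rG.
suff -> : b = t.+1 by [].
apply/eqP; rewrite eqn_leq lt_tb andbT.
move: noe_b; rewrite noe_m => -[->]; apply: leq_trans le_md _.
by rewrite ltnS -lee_nat -top_d; apply: ub_t; exists n, rG.
Qed.
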